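(* Let $R$ be a reversible ring and let $\alpha$ be an endomorphism of $R$ such that for all $a,b\in R$, $ab=0$ implies $a\alpha(b)=0$. If $\alpha^{k}=\mathrm{id}_R$ for some positive integer $k$, then the polynomial ring $R[x]$ is an $\overline{\alpha}$-skew almost Armendariz ring, where $\overline{\alpha}:R[x]\to R[x]$ is given by $\overline{\alpha}\left(\sum_i a_i x^i\right)=\sum_i \alpha(a_i)x^i$.
   Context: All rings are associative with unity (not necessarily commutative). A ring $R$ is reversible if $ab=0$ implies $ba=0$ for all $a,b\in R$. $N_*(S)$ denotes the prime radical (lower nil radical) of a ring $S$, i.e. the intersection of all prime ideals of $S$. For an endomorphism $\sigma$ of a ring $S$, the skew polynomial ring $S[y;\sigma]$ consists of polynomials in $y$ with coefficients in $S$ written on the left, with multiplication determined by $ys=\sigma(s)y$ for $s\in S$. A ring $S$ with endomorphism $\sigma$ is $\sigma$-skew almost Armendariz if whenever $f=\sum_{i=0}^m a_iy^i$ and $g=\sum_{j=0}^n b_jy^j$ in $S[y;\sigma]$ satisfy $fg=0$, then $a_i\sigma^i(b_j)\in N_*(S)$ for all $0\le i\le m$, $0\le j\le n$. *)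

(* Defs.v *)
From HB Require Import structures.
From mathcomp Require Import all_boot all_algebra.

Set Implicit Arguments.
Unset Strict Implicit.
Unset Printing Implicit Defensive.

Import GRing.Theory.
Local Open Scope ring_scope.

Definition reversible (R : nzRingType) : Prop :=
  forall a b : R, a * b = 0 -> b * a = 0.

(* The library's ideals (ring_quotient) are decidable left ideals and its
   prime ideals are completely prime; the prime radical of a noncommutative
   ring needs arbitrary two-sided ideals, primality being about products of
   ideals. *)

Record two_sided_ideal (S : nzRingType) (I : S -> Prop) : Prop := {
  tideal0 : I 0;
  tidealB : forall x y, I x -> I y -> I (x - y);
  tidealMl : forall s x, I x -> I (s * x);
  tidealMr : forall s x, I x -> I (x * s)
}.

(* [A B <= P] for the ideal product amounts to [x * y] lying in [P] for all
   [x] in [A] and [y] in [B], since [P] is closed under sums. *)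
Record prime_ideal (S : nzRingType) (P : S -> Prop) : Prop := {
  prime_ideal_ideal : two_sided_ideal P;
  prime_ideal_proper : exists x, ~ P x;
  prime_ideal_mul : forall A B : S -> Prop,
    two_sided_ideal A -> two_sided_ideal B ->
    (forall x y, A x -> B y -> P (x * y)) ->
    (forall x, A x -> P x) \/ (forall y, B y -> P y)
}.

Definition prime_radical (S : nzRingType) (x : S) : Prop :=
  forall P : S -> Prop, prime_ideal P -> P x.

(* [S[y; sigma]]: the left [S]-module of polynomials with coefficients on the
   left, with the product determined by [y * s = sigma s * y], that is
   [(a y^i) (b y^j) = a sigma^i(b) y^(i + j)]. *)
Definition skew_poly (S : nzRingType) (sigma : {rmorphism S -> S}) : Type :=
  {poly S}.

Section SkewPolyRing.

Variables (S : nzRingType) (sigma : {rmorphism S -> S}).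

HB.instance Definition _ := GRing.Zmodule.copy (skew_poly sigma) {poly S}.

Implicit Types p q r : {poly S}.

Definition skew_mul_def p q : {poly S} :=
  \poly_(n < size p + size q) \sum_(i < n.+1) p`_i * iter i sigma q`_(n - i).
Fact skew_mul_key : unit. Proof. by []. Qed.
Definition skew_mul := locked_with skew_mul_key skew_mul_def.
Canonical skew_mul_unlockable := [unlockable fun skew_mul].

Lemma iter_rmorph0 n : iter n sigma 0 = 0.
Proof. by elim: n => //= n ->; rewrite rmorph0. Qed.

Lemma iter_rmorph1 n : iter n sigma 1 = 1.
Proof. by elim: n => //= n ->; rewrite rmorph1. Qed.

Lemma iter_rmorphD n : {morph iter n sigma : x y / x + y}.
Proof. by move=> x y; elim: n => //= n ->; rewrite rmorphD. Qed.

Lemma iter_rmorphM n : {morph iter n sigma : x y / x * y}.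
Proof. by move=> x y; elim: n => //= n ->; rewrite rmorphM. Qed.

Lemma iter_rmorph_sum n (I : Type) (s : seq I) (P : pred I) (F : I -> S) :
  iter n sigma (\sum_(i <- s | P i) F i)
    = \sum_(i <- s | P i) iter n sigma (F i).
Proof. exact: (big_morph _ (iter_rmorphD n) (iter_rmorph0 n)). Qed.

Lemma coef_skew_mul p q n :
  (skew_mul p q)`_n = \sum_(i < n.+1) p`_i * iter i sigma q`_(n - i).
Proof.
rewrite unlock coef_poly; case: ltnP => // le_pq_n.
rewrite big1 // => i _; have [le_p_i|lt_i_p] := leqP (size p) i.
  by rewrite nth_default ?mul0r.
rewrite [q`__]nth_default ?iter_rmorph0 ?mulr0 //.
by rewrite leq_subRL ?leq_ord // (leq_trans _ le_pq_n) // leq_add2r ltnW.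
Qed.

Lemma coef_skew_mul_rev p q n :
  (skew_mul p q)`_n = \sum_(i < n.+1) p`_(n - i) * iter (n - i) sigma q`_i.
Proof.
rewrite coef_skew_mul (reindex_inj rev_ord_inj) /=.
by apply: eq_bigr => j _; rewrite (sub_ordK j).
Qed.

Lemma skew_mulA : associative skew_mul.
Proof.
move=> p q r; apply/polyP=> i; rewrite coef_skew_mul coef_skew_mul_rev.
pose coef3 j k :=
  p`_j * (iter j sigma q`_(i - j - k) * iter (i - k) sigma r`_k).
transitivity (\sum_(j < i.+1) \sum_(k < i.+1 | (k <= i - j)%N) coef3 j k).
  apply: eq_bigr => /= j _.
  rewrite coef_skew_mul_rev iter_rmorph_sum big_distrr /=.
  rewrite (big_ord_narrow_leq (leq_subr _ _)); apply: eq_bigr => k _ /=.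
  rewrite iter_rmorphM -iterD /coef3 addnBA ?leq_ord //.
  by rewrite subnKC ?leq_ord.
rewrite (exchange_big_dep predT) //=; apply: eq_bigr => k _.
transitivity (\sum_(j < i.+1 | (j <= i - k)%N) coef3 j k).
  apply: eq_bigl => j; rewrite -ltnS -(ltnS j) -!subSn ?leq_ord //.
  by rewrite -subn_gt0 -(subn_gt0 j) -!subnDA addnC.
rewrite (big_ord_narrow_leq (leq_subr _ _)) coef_skew_mul big_distrl /=.
by apply: eq_bigr => j _; rewrite /coef3 -!subnDA addnC mulrA.
Qed.

Lemma skew_mul1p : left_id 1%:P skew_mul.
Proof.
move=> p; apply/polyP => i; rewrite coef_skew_mul big_ord_recl subn0.
by rewrite big1 => [|j _]; rewrite coefC /= ?mul1r ?addr0 ?mul0r.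
Qed.

Lemma skew_mulp1 : right_id 1%:P skew_mul.
Proof.
move=> p; apply/polyP => i; rewrite coef_skew_mul_rev big_ord_recl subn0.
rewrite big1 => [|j _]; rewrite coefC /=.
  by rewrite iter_rmorph1 mulr1 addr0.
by rewrite iter_rmorph0 mulr0.
Qed.

Lemma skew_mulDl : left_distributive skew_mul +%R.
Proof.
move=> p q r; apply/polyP=> i; rewrite coefD !coef_skew_mul -big_split.
by apply: eq_bigr => j _; rewrite coefD mulrDl.
Qed.

Lemma skew_mulDr : right_distributive skew_mul +%R.
Proof.
move=> p q r; apply/polyP=> i; rewrite coefD !coef_skew_mul -big_split.
by apply: eq_bigr => j _; rewrite coefD iter_rmorphD mulrDr.
Qed.

HB.instance Definition _ := GRing.Zmodule_isNzRing.Build (skew_poly sigma)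
  skew_mulA skew_mul1p skew_mulp1 skew_mulDl skew_mulDr (poly1_neq0 S).

Lemma coef_skewM (f g : skew_poly sigma) n :
  (f * g)`_n = \sum_(i < n.+1) f`_i * iter i sigma g`_(n - i).
Proof. exact: coef_skew_mul. Qed.

Lemma skew_mulXC (s : S) :
  ('X : skew_poly sigma) * (s%:P : skew_poly sigma)
    = ((sigma s)%:P : skew_poly sigma) * ('X : skew_poly sigma).
Proof.
apply/polyP=> n; rewrite !coef_skewM.
rewrite [RHS]big_ord_recl coefC /= subn0 coefX.
rewrite [X in _ = _ + X]big1 ?addr0; last by move=> i _; rewrite coefC mul0r.
case: n => [|n]; first by rewrite big_ord1 coefX /= mul0r mulr0.
rewrite big_ord_recl big_ord_recl !coefX /= mul0r add0r mul1r subSS subn0.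
rewrite big1 ?addr0; last by move=> i _; rewrite coefX mul0r.
by rewrite coefC eqSS; case: eqP => _; rewrite ?mulr1 ?rmorph0 ?mulr0.
Qed.

End SkewPolyRing.

Definition skew_almost_Armendariz (S : nzRingType) (sigma : {rmorphism S -> S})
  : Prop :=
  forall f g : skew_poly sigma, f * g = 0 ->
  forall i j : nat, prime_radical (f`_i * iter i sigma g`_j).

(* Main.v *)
(** The nilpotent elements of a reversible ring [R] form an ideal [N] with [R/N]
    reduced, and [N] lies under every prime ideal of [R[x]].  Compatibility and
    [alpha^k = id] give [a b \in N] iff [a alpha^i(b) \in N].  If [f g = 0], an
    induction on bidegrees as in Armendariz's theorem then shows that all products
    of a coefficient of [f] and a coefficient of [g] lie in [N]: multiplying the
    bidegree equation on the left by a coefficient [a] of [f] kills, modulo [N],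
    every term but the one starting with [a]. *)
Require Import Defs.
From mathcomp Require Import all_boot all_algebra.
From Stdlib Require Import Classical.

Import GRing.Theory.
Local Open Scope ring_scope.

Section TwoSidedIdeals.

Context {S : nzRingType} {I : S -> Prop} (idI : two_sided_ideal I).

Lemma tidealD x y : I x -> I y -> I (x + y).
Proof.
move=> Ix Iy; rewrite -[y]opprK -[- y]sub0r.
exact: (tidealB idI) Ix (tidealB idI (tideal0 idI) Iy).
Qed.

Lemma tideal_sum (T : finType) (P : pred T) (F : T -> S) :
  (forall i, P i -> I (F i)) -> I (\sum_(i | P i) F i).
Proof. by move=> IF; elim/big_ind: _ => //; [exact: tideal0 | exact: tidealD]. Qed.

Hypothesis sqI : forall a, I (a * a) -> I a.

Lemma semiprime_mulC a b : I (a * b) -> I (b * a).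
Proof.
move=> Iab; apply: sqI.
by rewrite -mulrA [a * _]mulrA; apply/(tidealMl idI)/(tidealMr idI).
Qed.

Lemma semiprime_insert a r b : I (a * b) -> I (a * r * b).
Proof.
move=> /semiprime_mulC Iba; apply: semiprime_mulC.
by rewrite mulrA; apply: (tidealMr idI).
Qed.

Lemma semiprime_mul_sq a b : I (a * (a * b)) -> I (a * b).
Proof.
move=> /semiprime_mulC Iaba; apply: sqI; rewrite mulrA.
exact: (tidealMr idI).
Qed.

End TwoSidedIdeals.

Lemma tideal_coef (R : nzRingType) (I : {poly R} -> Prop) (p : {poly R}) :
  two_sided_ideal I -> (forall n, I (p`_n)%:P) -> I p.
Proof.
move=> idI Icoef; rewrite -[p]coefK poly_def; apply: (tideal_sum idI) => n _.
by rewrite -mul_polyC; apply: (tidealMr idI).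
Qed.

(** Primality is applied to [A] and to the set of all [b] with [A b] inside [P]. Unlike the ideal
    generated by [y], this set needs no sums of products, and it contains [y] by the case
    [s = 1]. *)
Lemma prime_ideal_mulP (S : nzRingType) (P : S -> Prop) (x y : S) :
  prime_ideal P -> (forall s, P (x * s * y)) -> P x \/ P y.
Proof.
move=> prP Pxy; have idP := prime_ideal_ideal prP.
pose A a := forall s, P (a * s * y).
have idA : two_sided_ideal A.
  split=> [s|a b Aa Ab s|r a Aa s|r a Aa s].
  - by rewrite !mul0r; apply: tideal0.
  - by rewrite !mulrBl; apply: (tidealB idP).
  - by rewrite -!mulrA; apply: (tidealMl idP); rewrite mulrA.
  - by rewrite -(mulrA a).
have idB : two_sided_ideal (fun b => forall a, A a -> P (a * b)).
  split=> [a _|b c Bb Bc a Aa|r b Bb a Aa|r b Bb a Aa].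
  - by rewrite mulr0; apply: tideal0.
  - by rewrite mulrBr; apply: (tidealB idP); [apply: Bb | apply: Bc].
  - by rewrite mulrA; apply/Bb/(tidealMr idA).
  - by rewrite mulrA; apply/(tidealMr idP)/Bb.
case: (prime_ideal_mul prP idA idB) => [a b Aa|sAP|sBP]; first exact.
  by left; apply: sAP.
by right; apply: sBP => a /(_ 1); rewrite mulr1.
Qed.

Lemma coef_iter_map_poly (R : nzRingType) (alpha : {rmorphism R -> R}) i
    (p : {poly R}) s : (iter i (map_poly alpha) p)`_s = iter i alpha p`_s.
Proof. by elim: i => //= i IH; rewrite coef_map IH. Qed.

Lemma skew_Armendariz_modulo (R : nzRingType) (alpha : {rmorphism R -> R})
    (I : R -> Prop) (f g : skew_poly (map_poly alpha)) :
    two_sided_ideal I -> (forall a, I (a * a) -> I a) ->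
    (forall a b i, I (a * iter i alpha b) <-> I (a * b)) ->
  f * g = 0 -> forall i j s t, I (f`_i`_s * g`_j`_t).
Proof.
move=> idI sqI compat fg0.
(* The coefficient of [y^m x^n] in [f * g]. *)
have eq0 m n : \sum_(i < m.+1) \sum_(s < n.+1)
    f`_i`_s * iter i alpha g`_(m - i)`_(n - s) = 0.
  have := congr1 (fun p : {poly {poly R}} => p`_m`_n) fg0.
  rewrite /= coef_skewM coef_sum !coef0; apply: etrans.
  apply: eq_bigr => i _; rewrite coefM; apply: eq_bigr => s _.
  by rewrite coef_iter_map_poly.
suff main m n i s : (i <= m)%N -> (s <= n)%N ->
      I (f`_i`_s * g`_(m - i)`_(n - s)).
  move=> i j s t; have := main (i + j)%N (s + t)%N i s.
  by rewrite !addKn !leq_addr; apply.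
(* Lexicographic induction: the degree [m] in [y], the degree [n] in [x], then the position [(i, s)]
   within the equation [eq0 m n]. *)
elim/ltn_ind: m n i s => m IHm n; elim/ltn_ind: n => n IHn i.
elim/ltn_ind: i => i IHi s; elim/ltn_ind: s => s IHs le_im le_sn.
have lt_im : (i < m.+1)%N by [].
have lt_sn : (s < n.+1)%N by [].
set a := f`_i`_s.
have /eqP := congr1 ( *%R a) (eq0 m n); rewrite mulr0.
rewrite (bigD1 (Ordinal lt_im)) //= (bigD1 (Ordinal lt_sn)) //= -addrA mulrDr.
rewrite addr_eq0 => /eqP Ea.
(* Semiprimeness of [I] lets the extra left factor [a] be cancelled at the end. *)
apply/(compat _ _ i)/(semiprime_mul_sq idI sqI); rewrite {}Ea -sub0r.
apply: (tidealB idI (tideal0 idI)); rewrite mulrDr; apply: (tidealD idI).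
  rewrite mulr_sumr; apply: (tideal_sum idI) => -[t /= lt_tn].
  rewrite -val_eqE /= neq_ltn => /orP[lt_ts|lt_st].
    by apply/(tidealMl idI)/compat/IHs.
  (* For [t > s], the outer factors [a] and [g]_(m - i)[_(n - t)] have total degree less than [n] in
     [x], so their product is already in [I]. *)
  rewrite mulrA; apply/(semiprime_insert idI sqI)/compat.
  have lt_n : (s + (n - t) < n)%N by rewrite -ltn_subRL ltn_sub2l // (leq_trans lt_st).
  by have := IHn _ lt_n i s le_im (leq_addr _ _); rewrite addKn.
rewrite mulr_sumr; apply: (tideal_sum idI) => -[j /= lt_jm].
rewrite -val_eqE /= mulr_sumr neq_ltn => lt_ij.
apply: (tideal_sum idI) => -[t /= lt_tn] _; case/orP: lt_ij => [lt_ji|lt_ij].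
  by apply/(tidealMl idI)/compat/IHi.
(* For [j > i], the outer factors have total degree less than [m] in [y]; their degree in [x] is
   then irrelevant. *)
rewrite mulrA; apply/(semiprime_insert idI sqI)/compat.
have lt_m : (i + (m - j) < m)%N by rewrite -ltn_subRL ltn_sub2l // (leq_trans lt_ij).
have := IHm _ lt_m (s + (n - t))%N i s (leq_addr _ _) (leq_addr _ _).
by rewrite !addKn.
Qed.

Definition nilp {R : nzRingType} (a : R) : Prop := exists n, a ^+ n = 0.

Section ReversibleRings.

Context {R : nzRingType} (hrev : reversible R).

Lemma reversible_insert (a r b : R) : a * b = 0 -> a * r * b = 0.
Proof. by move=> /hrev ba0; apply: hrev; rewrite mulrA ba0 mul0r. Qed.

(* The left factor [u] is what makes the inductions on exponents below go
   through: it absorbs the factors already split off from the power. *)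
Lemma reversible_exprMl (u r a : R) n : u * a ^+ n = 0 -> u * (r * a) ^+ n = 0.
Proof.
elim: n u => // n IH u; rewrite !exprS !mulrA => uaa0; apply: IH.
by rewrite -mulrA; apply: reversible_insert; rewrite mulrA.
Qed.

Lemma reversible_exprMr (u a r : R) n : u * a ^+ n = 0 -> u * (a * r) ^+ n = 0.
Proof.
elim: n u => // n IH u; rewrite !exprS !mulrA => uaa0; apply: IH.
exact: reversible_insert.
Qed.

(** Since [a] and [b] need not commute, there is no binomial formula. Instead one factor [a + b] is
    expanded at a time: [u] absorbs [a] or [b], which lowers [n] or [m]. *)
Lemma reversible_exprD (u a b : R) n m :
  u * a ^+ n = 0 -> u * b ^+ m = 0 -> u * (a + b) ^+ (n + m) = 0.
Proof.
elim: n m u => [|n IHn] m u; first by rewrite mulr1 => ->; rewrite !mul0r.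
elim: m u => [|m IHm] u ua0; first by rewrite mulr1 => ->; rewrite mul0r.
move=> ub0; rewrite addSn exprS mulrA mulrDr mulrDl.
rewrite (IHn m.+1 (u * a)) ?add0r; last exact: reversible_insert.
  by rewrite addnS -addSn IHm //; [exact: reversible_insert | rewrite -mulrA -exprS].
by rewrite -mulrA -exprS.
Qed.

Lemma nilp_ideal : two_sided_ideal (@nilp R).
Proof.
split=> [|a b [n an0] [m bm0]|r a [n an0]|r a [n an0]].
- by exists 1%N; rewrite expr1.
- exists (n + m)%N; rewrite -[LHS]mul1r; apply: reversible_exprD; rewrite mul1r //.
  by rewrite exprNn bm0 mulr0.
- by exists n; rewrite -[LHS]mul1r; apply: reversible_exprMl; rewrite mul1r.
- by exists n; rewrite -[LHS]mul1r; apply: reversible_exprMr; rewrite mul1r.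
Qed.

Lemma nilp_sq (a : R) : nilp (a * a) -> nilp a.
Proof. by case=> n an0; exists (2 * n)%N; rewrite exprM. Qed.

(** With a constant right factor, insertion in [{poly R}] reduces to insertion in [R], coefficient
    by coefficient. *)
Lemma reversible_poly_insert (u s : {poly R}) (c : R) :
  u * c%:P = 0 -> u * s * c%:P = 0.
Proof.
move=> uc0; have ucoef0 i : u`_i * c = 0.
  by rewrite -coefMC uc0 coef0.
apply/polyP=> n; rewrite coefMC coef0 coefM mulr_suml big1 // => i _.
exact: reversible_insert.
Qed.

Lemma nilp_prime (P : {poly R} -> Prop) (a : R) :
  prime_ideal P -> nilp a -> P a%:P.
Proof.
move=> prP [n an0]; have [//|nPa] := classic (P a%:P).
(* In the induction, [u s a] is killed by the lower power for every [s], hence lies in [P];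
   primality then gives [u] in [P]. *)
suff Pu u : u * (a ^+ n)%:P = 0 -> P u by apply: Pu; rewrite an0 mulr0.
elim: n {an0} u => [|n IHn] u.
  by rewrite mulr1 => ->; apply: tideal0; apply: prime_ideal_ideal.
rewrite exprS => ua0.
have [s|//|//] := @prime_ideal_mulP _ P u a%:P prP.
by apply: IHn; rewrite -(mulrA (u * s)) -polyCM; apply: reversible_poly_insert.
Qed.

Section Endomorphism.

Context {alpha : {rmorphism R -> R}}.
Hypothesis hcompat : forall a b : R, a * b = 0 -> a * alpha b = 0.

(** Reversibility rotates [b] to the right end, where [hcompat] applies, and back. *)
Lemma reversible_compat_mid (a b c : R) : a * b * c = 0 -> a * alpha b * c = 0.
Proof.
move=> /hrev; rewrite mulrA => /hcompat cab0.
by apply: hrev; rewrite mulrA.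
Qed.

Lemma nilp_compat (a b : R) : nilp (a * b) -> nilp (a * alpha b).
Proof.
case=> n abn0; exists n; rewrite -[LHS]mul1r.
have: 1 * (a * b) ^+ n = 0 by rewrite mul1r.
elim: n 1 {abn0} => // n IHn u; rewrite !exprS !mulrA => uab0.
exact/IHn/reversible_compat_mid.
Qed.

Lemma nilp_iter_compat (k : nat) (a b : R) (i : nat) :
    (0 < k)%N -> (forall c, iter k alpha c = c) ->
  nilp (a * iter i alpha b) <-> nilp (a * b).
Proof.
move=> k_gt0 alphak.
have iter_compat j c : nilp (a * c) -> nilp (a * iter j alpha c).
  by elim: j => //= j IHj ac; apply/nilp_compat/IHj.
(* To undo [i] twists, apply more of them until their number is [i * k], where the iterate is the
   identity. *)
split=> [/(iter_compat (i * k - i)%N)|]; last exact: iter_compat.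
rewrite -iterD subnK ?leq_pmulr //.
suff -> : iter (i * k) alpha b = b by [].
by elim: i => //= i IHi; rewrite mulSn iterD IHi.
Qed.

End Endomorphism.

End ReversibleRings.

Theorem theorem3p2 (R : nzRingType) (alpha : {rmorphism R -> R}) (k : nat)
    (hrev : reversible R)
    (hcompat : forall a b : R, a * b = 0 -> a * alpha b = 0)
    (hk : (0 < k)%N)
    (halpha : forall a : R, iter k alpha a = a) :
  skew_almost_Armendariz (map_poly alpha).
Proof.
move=> f g fg0 i j P prP; have idP := prime_ideal_ideal prP.
have idN := nilp_ideal hrev.
have compat a b n := nilp_iter_compat hrev hcompat k a b n hk halpha.
have Nfg := skew_Armendariz_modulo _ _ _ _ _ idN (@nilp_sq R) compat fg0 i j.
apply: (tideal_coef _ _ _ idP) => n; apply: (nilp_prime hrev _ _ prP).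
rewrite coefM; apply: (tideal_sum idN) => s _.
by rewrite coef_iter_map_poly; apply/compat.
Qed.
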